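(* Let $X$ be the Cantor set, let $Y \subseteq X$ be clopen with $Y \neq \emptyset, X$, and let $Z = X - Y$. Let $\{y_n\}_{n\in\mathbb{N}}$ and $\{z_n\}_{n\in\mathbb{N}}$ be countable dense subsets of $Y$ and $Z$ respectively (each enumerated without repetition), and let $\mathcal{Z} = \{\{y_n,z_n\} \mid n \in \mathbb{N}\}$. For each $n$ let $f_n \in D(X)$ satisfy $f_n \geq 1$ and $f_n^{-1}(+\infty) = \{y_n,z_n\}$, let $S$ be the set of all finite real linear combinations $\sum_{i\in I} r_i f_i$, and let $A = A(X,\mathcal{Z}) = C(X)+S \subseteq D(X)$. Then $A$, with the constant function $1$ as distinguished weak order unit, is an archimedean vector lattice with weak order unit whose Yosida space is $YA = X$ (thus zero-dimensional), and $A$ fails SMP (sufficiently many projections).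
   Context: For compact Hausdorff $X$, $D(X)$ is the set of continuous $f : X \to \mathbb{R} \cup \{\pm\infty\}$ with $f^{-1}(\mathbb{R})$ dense in $X$; it is a lattice under pointwise order, closed under multiplication by real scalars, with addition only partially defined: $f+g=h$ in $D(X)$ means $h \in D(X)$ and $h(x)=f(x)+g(x)$ on the dense set where $f$ and $g$ are both finite. The sums used in forming $S$ and $C(X)+S$ all exist in $D(X)$, because the sets $f_n^{-1}(+\infty)$ are pairwise disjoint. A weak order unit of a vector lattice $A$ is $u>0$ such that $|a|\wedge u = 0$ implies $a=0$. For $(A,u)$ an archimedean vector lattice with distinguished weak order unit, the Yosida space $YA$ is the compact Hausdorff space of all ideals $M$ of $A$ maximal with respect to $u \notin M$, with the hull-kernel topology. The Yosida representation is a vector lattice isomorphism $\eta$ of $A$ onto a subset $\eta(A) \subseteq D(YA)$ (with all sums of elements of $\eta(A)$ existing in $D(YA)$ and lying in $\eta(A)$) with $\eta(u)=1$ and such that $\eta(A)$ 0-1 separates disjoint closed sets of $YA$ (for disjoint closed $E,F$ some element is $0$ on $E$ and $1$ on $F$). For a vector lattice $A \subseteq D(X)$ containing the constant $1$ as distinguished unit, ''$YA = X$'' means that the inclusion $A \subseteq D(X)$ is the Yosida representation of $A$, up to a homeomorphism of $X$ with $YA$. A space is zero-dimensional (ZD) if its clopen sets form a base. A band in $A$ is an ideal closed under existing suprema of subsets of its elements; a projection band is a band $B$ for which $A = B \oplus B'$ for some band $B' \subseteq A$. $A$ has sufficiently many projections (SMP) if each nonzero band contains a nonzero projection band. *)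

(* Defs.v *)
From HB Require Import structures.
From mathcomp Require Import all_boot all_order all_algebra.
From mathcomp Require Import all_classical all_reals all_analysis.

Set Implicit Arguments.
Unset Strict Implicit.
Unset Printing Implicit Defensive.

Import Order.TTheory GRing.Theory Num.Theory.
Import numFieldNormedType.Exports.

Local Open Scope classical_set_scope.
Local Open Scope ring_scope.

(* Joins and meets are mixin fields and not an Order.Lattice structure, which
   HB refuses here: it would need a new join below Num.RealDomain. *)
HB.mixin Record isVectorLattice (R : realType) V
    & GRing.Lmodule R V & Num.POrderedZmodule V := {
  vjoin : V -> V -> V ;
  vmeet : V -> V -> V ;
  vjoin_le : forall a b c : V, (vjoin a b <= c) = (a <= c) && (b <= c) ;
  vle_meet : forall a b c : V, (c <= vmeet a b) = (c <= a) && (c <= b) ;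
  vlat_leD2r : forall c a b : V, a <= b -> a + c <= b + c ;
  vlat_scale_ge0 : forall (r : R) (a : V), 0 <= r -> 0 <= a -> 0 <= r *: a }.

#[short(type="vectorLatticeType")]
HB.structure Definition VectorLattice (R : realType) :=
  { V of isVectorLattice R V & GRing.Lmodule R V & Num.POrderedZmodule V }.

Section VectorLatticeDefs.
Context {R : realType} (V : vectorLatticeType R).
Implicit Types (a b u : V) (I J B M : set V).

Definition vabs a : V := vjoin a (- a).

Definition archimedean : Prop :=
  forall a b, 0 <= a -> 0 <= b -> (forall n : nat, a *+ n <= b) -> a = 0.

Definition weak_order_unit u : Prop :=
  0 < u /\ forall a, vmeet (vabs a) u = 0 -> a = 0.

Definition ideal I : Prop :=
  [/\ I 0,
      forall a b, I a -> I b -> I (a + b),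
      forall (r : R) a, I a -> I (r *: a) &
      forall a b, I a -> vabs b <= vabs a -> I b].

Definition maximal_avoiding u M : Prop :=
  [/\ ideal M, ~ M u &
      forall J, ideal J -> ~ J u -> M `<=` J -> J = M].

Definition band B : Prop :=
  ideal B /\ forall (S : set V) s, S `<=` B -> supremums S s -> B s.

Definition direct_sum B B' : Prop :=
  B `&` B' = [set 0] /\
  forall a, exists b b', [/\ B b, B' b' & a = b + b'].

Definition projection_band B : Prop :=
  band B /\ exists B', band B' /\ direct_sum B B'.

Definition SMP : Prop :=
  forall B, band B -> B <> [set 0] ->
    exists P, [/\ projection_band P, P <> [set 0] & P `<=` B].

End VectorLatticeDefs.
Arguments archimedean {R} V.
Arguments SMP {R} V.

Section VectorLatticeTheory.
Context {R : realType} {V : vectorLatticeType R}.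
Implicit Types (a b c u : V).

Lemma vlat_leD a b c d : a <= b -> c <= d -> a + c <= b + d.
Proof.
move=> ab cd; apply: (le_trans (vlat_leD2r c _ _ ab)).
by rewrite ![b + _]addrC; exact: vlat_leD2r.
Qed.

Lemma vlat_lerBlD a b c : (a - b <= c) = (a <= c + b).
Proof.
by apply/idP/idP => [/(vlat_leD2r b)|/(vlat_leD2r (- b))];
  rewrite ?subrK ?addrK.
Qed.

Lemma vlat_subr_ge0 a b : (0 <= b - a) = (a <= b).
Proof.
by apply/idP/idP => [/(vlat_leD2r a)|/(vlat_leD2r (- a))];
  rewrite ?subrK ?add0r ?subrr.
Qed.

Lemma vlat_lerN2 a b : (- a <= - b) = (b <= a).
Proof. by rewrite -(vlat_subr_ge0 (- a)) opprK addrC vlat_subr_ge0. Qed.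

Lemma vlat_ler_wpZ (r : R) a b : 0 <= r -> a <= b -> r *: a <= r *: b.
Proof.
move=> r0; rewrite -vlat_subr_ge0 => /(vlat_scale_ge0 _ _ r0).
by rewrite scalerBr vlat_subr_ge0.
Qed.

Lemma vlat_leZr (r s : R) a : 0 <= a -> r <= s -> r *: a <= s *: a.
Proof.
move=> a0 rs; rewrite -vlat_subr_ge0 -scalerBl.
by apply: vlat_scale_ge0 => //; rewrite subr_ge0.
Qed.

Lemma le_vabs a : a <= vabs a.
Proof. by have := vjoin_le a (- a) (vabs a); rewrite lexx => /esym/andP[]. Qed.

Lemma leN_vabs a : - a <= vabs a.
Proof. by have := vjoin_le a (- a) (vabs a); rewrite lexx => /esym/andP[]. Qed.

Lemma vmeet_lel a b : vmeet a b <= a.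
Proof. by have := vle_meet a b (vmeet a b); rewrite lexx => /esym/andP[]. Qed.

Lemma vmeet_ler a b : vmeet a b <= b.
Proof. by have := vle_meet a b (vmeet a b); rewrite lexx => /esym/andP[]. Qed.

Lemma vabs_ge0 a : 0 <= vabs a.
Proof.
have h : 0 <= vabs a *+ 2.
  by rewrite mulr2n -[X in X <= _](subrr a) vlat_leD ?le_vabs ?leN_vabs.
have i0 : 0 <= (2^-1 : R) by rewrite invr_ge0 ler0n.
have := vlat_scale_ge0 _ _ i0 h.
by rewrite -(scaler_nat 2 (vabs a)) scalerA mulVf ?scale1r ?pnatr_eq0.
Qed.

Lemma ger0_vabs a : 0 <= a -> vabs a = a.
Proof.
move=> a0; apply/eqP; rewrite eq_le le_vabs andbT vjoin_le lexx/=.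
by apply: (le_trans _ a0); rewrite -oppr0 vlat_lerN2.
Qed.

Lemma vabs_id a : vabs (vabs a) = vabs a.
Proof. exact: ger0_vabs (vabs_ge0 a). Qed.

Lemma vabs_le a b : a <= b -> - a <= b -> vabs a <= b.
Proof. by rewrite vjoin_le => -> ->. Qed.

Lemma vabsD a b : vabs (a + b) <= vabs a + vabs b.
Proof.
by apply: vabs_le; rewrite ?opprD vlat_leD ?le_vabs ?leN_vabs.
Qed.

Lemma vabsZ (r : R) a : vabs (r *: a) <= `|r| *: vabs a.
Proof.
case: (ger0P r) => [r0|/ltW r0].
  apply: vabs_le; rewrite -?scalerN;
    by apply: vlat_ler_wpZ; rewrite ?le_vabs ?leN_vabs.
have r0' : 0 <= - r by rewrite oppr_ge0.
apply: vabs_le.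
  by rewrite -[r *: a]opprK -scaleNr -scalerN vlat_ler_wpZ ?leN_vabs.
by rewrite -scaleNr vlat_ler_wpZ ?le_vabs.
Qed.

Lemma ideal_vabs (I : set V) a : ideal I -> I a -> I (vabs a).
Proof. by case=> _ _ _ sol Ia; apply: (sol a) => //; rewrite vabs_id. Qed.

(* Ideals maximal with respect to omitting u are prime. *)
Lemma maximal_avoiding_prime u (M : set V) a b : maximal_avoiding u M ->
  M (vmeet (vabs a) (vabs b)) -> M a \/ M b.
Proof.
move=> [iM Mu maxM] Mab; have [M0 MD MZ Ms] := iM.
pose J c : set V :=
  [set x | exists m (r : R), [/\ M m, 0 <= r & vabs x <= m + r *: vabs c]].
have iJ c : ideal (J c).
  split.
  - exists 0, 0; split=> //.
    by rewrite scale0r addr0 ger0_vabs.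
  - move=> x y [m [r [Mm r0 hx]]] [m' [r' [Mm' r0' hy]]].
    exists (m + m'), (r + r'); split; [exact: MD|exact: addr_ge0|].
    apply: (le_trans (vabsD x y)).
    by rewrite scalerDl addrACA vlat_leD.
  - move=> s x [m [r [Mm r0 hx]]].
    exists (`|s| *: m), (`|s| * r); split; [exact: MZ|exact: mulr_ge0|].
    by rewrite (le_trans (vabsZ s x))// -scalerA -scalerDr vlat_ler_wpZ.
  - move=> x y [m [r [Mm r0 hx]]] yx; exists m, r; split=> //.
    exact: le_trans hx.
have MJ c : M `<=` J c.
  move=> x Mx; exists (vabs x), 0; split=> //; first exact: ideal_vabs.
  by rewrite scale0r addr0.
have Ju c : ~ M c -> J c u.
  move=> Mc; apply: contrapT => nJu; apply: Mc.
  rewrite -(maxM _ (iJ c) nJu (MJ c)); exists 0, 1; split=> //.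
  by rewrite add0r scale1r.
apply: contrapT => /not_orP[/Ju[m [r [Mm r0 hu]]] /Ju[m' [r' [Mm' r0' hu']]]].
set c := vmeet (vabs a) (vabs b) in Mab.
have c0 : 0 <= c by rewrite vle_meet !vabs_ge0.
pose N := r + r' + 1; have N0 : 0 < N by rewrite ltr_wpDl// addr_ge0.
pose s := vabs m + vabs m'.
have key x (t : R) k : M k -> vabs k <= s -> t <= N ->
    vabs u <= k + t *: vabs x -> N^-1 *: (vabs u - s) <= vabs x.
  move=> Mk ks tN h.
  rewrite -[leRHS]scale1r -(mulVf (lt0r_neq0 N0)) -scalerA.
  apply: vlat_ler_wpZ; first by rewrite invr_ge0 ltW.
  rewrite vlat_lerBlD addrC (le_trans h)//.
  apply: vlat_leD; first exact: le_trans (le_vabs k) ks.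
  by apply: vlat_leZr => //; exact: vabs_ge0.
have hc : N^-1 *: (vabs u - s) <= c.
  rewrite vle_meet; apply/andP; split.
    apply: (key _ r m) => //.
      by rewrite -[leLHS]addr0 vlat_leD ?vabs_ge0.
    by rewrite /N -addrA lerDl addr_ge0.
  apply: (key _ r' m') => //.
    by rewrite -[leLHS]add0r vlat_leD ?vabs_ge0.
  by rewrite /N addrAC lerDr addr_ge0.
apply: Mu; apply: (Ms (s + N *: c)).
  by apply: (MD); [apply: (MD); exact: ideal_vabs|exact: MZ].
apply: le_trans (le_vabs _).
rewrite addrC -vlat_lerBlD.
have := vlat_ler_wpZ (ltW N0) hc.
by rewrite scalerA divff ?scale1r// lt0r_neq0.
Qed.

End VectorLatticeTheory.

Section YosidaSpace.
Context {R : realType} {V : vectorLatticeType R} (u : V).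

Record yosida_space := YosidaPoint {
  yosida_ideal :> set V ;
  yosida_idealP : maximal_avoiding u yosida_ideal }.

HB.instance Definition _ := gen_eqMixin yosida_space.
HB.instance Definition _ := gen_choiceMixin yosida_space.

Definition hull (F : set V) : set yosida_space := [set M | F `<=` M].

(* The closed sets of the hull-kernel topology are exactly the hulls. *)
Definition yosida_open : set_system yosida_space :=
  [set U | exists F : set V, U = ~` hull F].

Let yosida_openT : yosida_open setT.
Proof.
exists setT; apply/esym/seteqP; split=> // M _ /= /(_ u I) Mu.
by have [] := yosida_idealP M.
Qed.

Let yosida_openI : setI_closed yosida_open.
Proof.
move=> _ _ [F ->] [G ->].
exists [set c | exists a b,
  [/\ F a, G b & c = vmeet (vabs a) (vabs b)]].
apply/seteqP; split=> M /=.
  move=> [/existsNP[a /not_implyP[Fa Ma]] /existsNP[b /not_implyP[Gb Mb]]] h.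
  have : yosida_ideal M (vmeet (vabs a) (vabs b)) by apply: h; exists a, b.
  by case/(maximal_avoiding_prime (yosida_idealP M)).
have [[_ _ _ Ms] _ _] := yosida_idealP M.
move=> h; split=> hM; apply: h => _ [a [b [Fa Gb ->]]].
  apply: (Ms a); first exact: hM.
  by rewrite ger0_vabs ?vmeet_lel// vle_meet !vabs_ge0.
apply: (Ms b); first exact: hM.
by rewrite ger0_vabs ?vmeet_ler// vle_meet !vabs_ge0.
Qed.

Let yosida_open_bigU (I : Type) (f : I -> set yosida_space) :
  (forall i, yosida_open (f i)) -> yosida_open (\bigcup_i f i).
Proof.
move=> fo; exists (\bigcup_i [set a | exists F : set V, F a /\ f i = ~` hull F]).
apply/seteqP; split=> M /=.
  move=> [i _]; have [F fE] := fo i; rewrite fE => nFM h; apply: nFM => a Fa.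
  by apply: h; exists i => //; exists F.
move=> /existsNP[a /not_implyP[[i _ [F [Fa fE]]] Ma]].
by exists i => //; rewrite fE => /(_ a Fa).
Qed.

HB.instance Definition _ := isOpenTopological.Build yosida_space
  yosida_openT yosida_openI yosida_open_bigU.

End YosidaSpace.

Definition homeomorphism (T U : topologicalType) (h : T -> U) : Prop :=
  continuous h /\
  exists g : U -> T, [/\ cancel h g, cancel g h & continuous g].

Section ExtendedFunctions.
Context {R : realType} {T : topologicalType}.
Implicit Types f g h : T -> \bar R.

Definition Dspace : set (T -> \bar R) :=
  [set f | continuous f /\ dense [set x | f x \is a fin_num]].

Definition Dscale (r : R) f : T -> \bar R := fun x => (r%:E * f x)%E.

(* Partial addition: f + g = h in D(T). *)
Definition Dadd f g h : Prop :=
  [/\ Dspace f, Dspace g, Dspace h &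
      forall x, f x \is a fin_num -> g x \is a fin_num ->
        h x = (f x + g x)%E].

Fixpoint Dsum (s : seq (T -> \bar R)) h : Prop :=
  if s is f :: s' then exists2 k, Dsum s' k & Dadd f k h
  else h = cst 0%E.

Definition separates01 (F : set (T -> \bar R)) : Prop :=
  forall C E : set T, closed C -> closed E -> C `&` E = set0 ->
    exists f, [/\ F f, (forall x, C x -> f x = 0%E) &
                       (forall x, E x -> f x = 1%E)].

End ExtendedFunctions.
Arguments Dspace {R} T.

(* eta is an isomorphism of V onto its range, a vector lattice under the
   operations of D(T); lattice operations in D(T) are pointwise. *)
Definition Dembedding {R : realType} {V : vectorLatticeType R}
    {T : topologicalType} (eta : V -> T -> \bar R) : Prop :=
  injective eta /\
  [/\ forall a, Dspace T (eta a),
      forall a b, Dadd (eta a) (eta b) (eta (a + b)),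
      forall (r : R) a, eta (r *: a) = Dscale r (eta a),
      forall a b, eta (vjoin a b) =
        (fun x => Order.max (eta a x) (eta b x)) &
      forall a b, eta (vmeet a b) =
        (fun x => Order.min (eta a x) (eta b x))].

Definition yosida_representation {R : realType} {V : vectorLatticeType R}
    {u : V} (eta : V -> yosida_space u -> \bar R) : Prop :=
  [/\ Dembedding eta, eta u = cst 1%E & separates01 (range eta)].

(* YV = T for V identified with a subset of D(T) through iota *)
Definition yosida_space_is {R : realType} {V : vectorLatticeType R} (u : V)
    {T : topologicalType} (iota : V -> T -> \bar R) : Prop :=
  exists (h : T -> yosida_space u) (eta : V -> yosida_space u -> \bar R),
    [/\ homeomorphism h, yosida_representation eta &
        forall a, iota a = eta a \o h].

Definition ZD (T : topologicalType) : Prop := basis (@clopen T).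

Section CplusS.
Context {R : realType} {T : topologicalType} (f : nat -> T -> \bar R).

Definition Sspan : set (T -> \bar R) :=
  [set s | exists (I : seq nat) (r : nat -> R),
    uniq I /\ Dsum [seq Dscale (r i) (f i) | i <- I] s].

Definition CplusS : set (T -> \bar R) :=
  [set a | exists (g : T -> R) (s : T -> \bar R),
    [/\ continuous g, Sspan s & Dadd (EFin \o g) s a]].

End CplusS.

(* Main.v *)
(* The points where all f_n are finite form a dense set D, on which C(X) + S is
   a vector lattice of real functions; it is closed under positive parts because
   no two f_n are infinite at the same point. As C(X) + S contains C(X), it
   separates closed sets, so an ideal maximal with respect to omitting 1 is, by
   compactness of X, the set of elements vanishing at some point of X. An element
   of C(X) + S is finite at y_n if and only if it is finite at z_n. Let B be the
   band of elements vanishing off Y. A nonzero projection band P inside B splits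
   1 as p + p' with p = 1 near some y_n and p = 0 on Z; the component of f_n in P
   is then f_n near y_n but vanishes at z_n, which is impossible. *)
From HB Require Import structures.
Require Import Defs.
From mathcomp Require Import all_boot all_order all_algebra.
From mathcomp Require Import all_classical all_reals all_analysis.

Set Implicit Arguments.
Unset Strict Implicit.
Unset Printing Implicit Defensive.

Import Order.TTheory GRing.Theory Num.Theory.
Import numFieldNormedType.Exports.
Local Open Scope classical_set_scope.
Local Open Scope ring_scope.

Lemma cvg_eq_on_dense (T U : topologicalType) (D : set T) (f g : T -> U) x :
  hausdorff_space U -> closure D x ->
  f t @[t --> x] --> f x -> g t @[t --> x] --> g x ->
  (forall t, D t -> f t = g t) -> f x = g x.
Proof.
move=> hU Dx fx gx fg.
have PF : ProperFilter (within D (nbhs x)) by exact: within_nbhs_proper.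
apply: (cvg_unique hU (F := f @ within D (nbhs x))).
  exact: cvg_within_filter fx.
have gx' : g @ within D (nbhs x) --> g x by exact: cvg_within_filter gx.
apply: cvg_trans gx'; apply: near_eq_cvg.
by rewrite near_withinE; near=> t => Dt; rewrite fg.
Unshelve. all: by end_near. Qed.

Lemma dense_closureI (T : topologicalType) (D U : set T) x :
  dense D -> open U -> U x -> closure (U `&` D) x.
Proof.
move=> dD oU Ux W Wx.
move: Wx; rewrite nbhsE => -[V [oV Vx] VW].
have [||t [[Vt Ut] Dt]] := dD (V `&` U); first by exists x.
  exact: openI.
by exists t; split=> //; exact: VW.
Qed.

Lemma dense_closureT (T : topologicalType) (D : set T) x :
  dense D -> closure D x.
Proof.
by move=> dD; rewrite -(setTI D); apply: dense_closureI => //; exact: openT.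
Qed.

Section EReal.
Context {R : realType}.
Implicit Types a b : \bar R.
Local Open Scope ereal_scope.

Lemma abse_gt0 a : (0 < `|a|) = (a != 0).
Proof. by rewrite lt_neqAle abse_ge0 andbT eq_sym abse_eq0. Qed.

Lemma lte_between a b : a < b -> exists c, a < c < b.
Proof.
move: a b => [r| |] [s| |] //= ab.
- exists ((r + s) / 2)%:E; rewrite !lte_fin in ab *.
  by rewrite !midf_lt.
- by exists (r + 1)%:E; rewrite lte_fin ltrDl ltr01 ltry.
- by exists (s - 1)%:E; rewrite lte_fin gtrDl ltrN10 ltNyr.
- by exists 0; rewrite ltNy0 lt0y.
Qed.

Lemma abse_gt_fin a : a != 0 -> exists2 e : R, (0 < e)%R & e%:E < `|a|.
Proof.
rewrite -abse_gt0 => /lte_between[[e| |] /andP[e0 ea]].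
- by exists e; rewrite ?lte_fin in e0 *.
- by rewrite ltNge leey in ea.
- by rewrite ltNge leNye in e0.
Qed.

Lemma cvg_maxe (T : Type) (F : set_system T) (FF : Filter F)
    (f g : T -> \bar R) a b :
  f t @[t --> F] --> a -> g t @[t --> F] --> b ->
  maxe (f t) (g t) @[t --> F] --> maxe a b.
Proof.
move=> fa gb U; move: fa gb.
suff: f t @[t --> F] --> a -> g t @[t --> F] --> b -> nbhs (maxe a b) U ->
  F (fun t => U (maxe (f t) (g t))) by [].
wlog ab : f g a b / a <= b.
  move=> H fa gb; have /orP[ab|ba] := le_total a b; first exact: H.
  rewrite maxC => /(H g f b a ba gb fa).
  by apply: filterS => t /=; rewrite maxC.
move=> fa gb; rewrite max_r// => Ub.
move: ab; rewrite le_eqVlt => /predU1P[ab|/lte_between[c /andP[ac cb]]].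
  rewrite -ab in Ub gb.
  have fU : F (fun t => U (f t)) := fa _ Ub.
  have gU : F (fun t => U (g t)) := gb _ Ub.
  by apply: filterS2 fU gU => t ft gt; rewrite maxEle; case: ifP.
have gU : F (fun t => U (g t)) := gb _ Ub.
have fc : F (fun t => f t < c) := fa _ (open_ereal_lt' ac).
have cg : F (fun t => c < g t) := gb _ (open_ereal_gt' cb).
apply: filterS3 gU fc cg => t Ug ftc cgt.
by rewrite max_r// ltW// (lt_trans ftc).
Qed.

Lemma cvg_mine (T : Type) (F : set_system T) (FF : Filter F)
    (f g : T -> \bar R) a b :
  f t @[t --> F] --> a -> g t @[t --> F] --> b ->
  mine (f t) (g t) @[t --> F] --> mine a b.
Proof.
move=> fa gb; rewrite -[mine a b]oppeK oppe_min.
under eq_fun do rewrite -[mine _ _]oppeK oppe_min.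
by apply: cvgeN; apply: cvg_maxe; exact: cvgeN.
Qed.

Lemma continuous_EFin_comp (T : topologicalType) (g : T -> R) :
  continuous g -> continuous (EFin \o g).
Proof. by move=> gc x; apply: cvg_EFin; [exact: nearW|exact: gc]. Qed.

Lemma continuous_fine_comp (T : topologicalType) (h : T -> \bar R) :
  continuous h -> (forall x, h x \is a fin_num) ->
  continuous (fine \o h).
Proof.
by move=> hc hfin x; apply: fine_cvg; rewrite fineK; [exact: hc|exact: hfin].
Qed.

End EReal.

(** * Linear sublattices of a space of real functions *)

Section FunSublattice.
Context {R : realType} {X : Type}.

Record fun_sublattice := FunSublattice {
  fsl_carrier : set (X -> R) ;
  fsl0 : fsl_carrier (cst 0) ;
  fslD : forall a b, fsl_carrier a -> fsl_carrier b ->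
    fsl_carrier (fun x => a x + b x) ;
  fslZ : forall r a, fsl_carrier a -> fsl_carrier (fun x => r * a x) ;
  fsl_pos : forall a, fsl_carrier a ->
    fsl_carrier (fun x => Num.max (a x) 0) }.

Variable L : fun_sublattice.

Definition fsl_pred : {pred X -> R} := mem (fsl_carrier L).

Lemma fsl_submod : submod_closed fsl_pred.
Proof.
split; first by apply/mem_set; exact: fsl0.
move=> r a b /set_mem La /set_mem Lb; apply/mem_set.
by apply: fslD => //; exact: fslZ.
Qed.

HB.instance Definition _ := GRing.isSubmodClosed.Build R (X -> R) fsl_pred
  fsl_submod.

Record fsl_elt := FslElt { fsl_fun :> X -> R ; _ : fsl_fun \in fsl_pred }.

HB.instance Definition _ := [isSub for fsl_fun].
HB.instance Definition _ := [Choice of fsl_elt by <:].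
HB.instance Definition _ := [SubChoice_isSubLmodule of fsl_elt by <:].

Implicit Types a b c : fsl_elt.

Lemma fsl_eltP a : fsl_carrier L a.
Proof. by case: a => a /= /set_mem. Qed.

Lemma fsl_eqP a b : (forall x, a x = b x) -> a = b.
Proof. by move=> ab; apply: val_inj; exact/funext. Qed.

Lemma fsl_funD a b x : (a + b) x = a x + b x.
Proof. by []. Qed.

Lemma fsl_funN a x : (- a) x = - a x.
Proof. by []. Qed.

Lemma fsl_fun0 x : (0 : fsl_elt) x = 0.
Proof. by []. Qed.

Lemma fsl_funZ r a x : (r *: a) x = r * a x.
Proof. by []. Qed.

Definition fsl_le a b := `[< forall x, a x <= b x >].

Fact fsl_le_refl : reflexive fsl_le.
Proof. by move=> a; exact/asboolP. Qed.

Fact fsl_le_anti : antisymmetric fsl_le.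
Proof.
move=> a b /andP[/asboolP ab /asboolP ba]; apply: fsl_eqP => x.
by apply/eqP; rewrite eq_le ab ba.
Qed.

Fact fsl_le_trans : transitive fsl_le.
Proof.
move=> b a c /asboolP ab /asboolP bc; apply/asboolP => x.
exact: le_trans (bc x).
Qed.

HB.instance Definition _ := Order.Le_isPOrder.Build ring_display fsl_elt
  fsl_le_refl fsl_le_anti fsl_le_trans.

Lemma fsl_leP a b : reflect (forall x, a x <= b x) (a <= b).
Proof. exact: asboolP. Qed.

Fact fsl_join_subproof a b : (fun x => Num.max (a x) (b x)) \in fsl_pred.
Proof.
apply/mem_set; have := fslD (fsl_eltP b) (fsl_pos (fsl_eltP (a - b))).
congr (fsl_carrier L _); apply/funext => x.
by rewrite addr_maxr addr0 addrC subrK.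
Qed.
Definition fsl_join a b := FslElt (fsl_join_subproof a b).
Definition fsl_meet a b := - fsl_join (- a) (- b).

Lemma fsl_joinE a b x : fsl_join a b x = Num.max (a x) (b x).
Proof. by []. Qed.

Lemma fsl_meetE a b x : fsl_meet a b x = Num.min (a x) (b x).
Proof. by rewrite fsl_funN fsl_joinE oppr_max !fsl_funN !opprK. Qed.

Fact fsl_join_le a b c : (fsl_join a b <= c) = (a <= c) && (b <= c).
Proof.
apply/fsl_leP/andP => [h|[/fsl_leP ac /fsl_leP bc] x].
  by split; apply/fsl_leP => x; have := h x;
    rewrite fsl_joinE ge_max => /andP[].
by rewrite fsl_joinE ge_max ac bc.
Qed.

Fact fsl_le_meet a b c : (c <= fsl_meet a b) = (c <= a) && (c <= b).
Proof.
apply/fsl_leP/andP => [h|[/fsl_leP ac /fsl_leP bc] x].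
  by split; apply/fsl_leP => x; have := h x;
    rewrite fsl_meetE le_min => /andP[].
by rewrite fsl_meetE le_min ac bc.
Qed.

Fact fsl_leD2r c a b : a <= b -> a + c <= b + c.
Proof. by move=> /fsl_leP ab; apply/fsl_leP => x; rewrite lerD2r. Qed.

Fact fsl_scale_ge0 (r : R) a : 0 <= r -> 0 <= a -> 0 <= r *: a.
Proof.
move=> r0 /fsl_leP a0; apply/fsl_leP => x.
by rewrite fsl_fun0 fsl_funZ mulr_ge0//; exact: a0.
Qed.

HB.instance Definition _ := isVectorLattice.Build R fsl_elt
  fsl_join_le fsl_le_meet fsl_leD2r fsl_scale_ge0.

Lemma fsl_vjoinE a b x : vjoin a b x = Num.max (a x) (b x).
Proof. exact: fsl_joinE. Qed.

Lemma fsl_vmeetE a b x : vmeet a b x = Num.min (a x) (b x).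
Proof. exact: fsl_meetE. Qed.

Lemma fsl_vabsE a x : vabs a x = `|a x|.
Proof. by rewrite fsl_vjoinE fsl_funN maxrN. Qed.

End FunSublattice.
Arguments fun_sublattice : clear implicits.
Arguments fsl_elt {R X} L.

Lemma fsl_archimedean (R : realType) (X : Type) (L : fun_sublattice R X) :
  archimedean (fsl_elt L).
Proof.
move=> a b /fsl_leP a0 _ nab; apply: fsl_eqP => x.
apply/eqP; rewrite fsl_fun0 eq_le a0 andbT leNgt; apply/negP => ax.
have fun_mulrn n : (a *+ n) x = a x *+ n.
  by elim: n => [|n IH]; rewrite ?mulr0n// !mulrS fsl_funD IH.
pose n := Num.bound `|b x / a x|; have /fsl_leP/(_ x) := nab n.
apply/negP; rewrite -ltNge fun_mulrn -mulr_natl -ltr_pdivrMr//.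
exact: le_lt_trans (ler_norm _) (archi_boundP (normr_ge0 _)).
Qed.

(** * Sublattices of D(X) *)

Record finite_on_sublattice {R : realType} {X : topologicalType} (D : set X)
    (A : set (X -> \bar R)) : Prop := FiniteOnSublattice {
  fos_continuous : forall h, A h -> continuous h ;
  fos_fin_num : forall h, A h -> forall x, D x -> h x \is a fin_num ;
  fos0 : A (cst 0%E) ;
  fosD : forall h k, A h -> A k ->
    exists2 l, A l & forall x, D x -> l x = (h x + k x)%E ;
  fosZ : forall r h, A h ->
    exists2 l, A l & forall x, D x -> l x = (r%:E * h x)%E ;
  fos_pos : forall h, A h ->
    exists2 l, A l & forall x, D x -> l x = maxe (h x) 0%E }.

(* The vector lattice consists of the restrictions to D of the elements of A,
   extended by 0 off D so that they are total real functions. *)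
Lemma Dembedding_of_sublattice (R : realType) (X : topologicalType)
    (D : set X) (A : set (X -> \bar R)) :
  dense D -> finite_on_sublattice D A ->
  exists (L : fun_sublattice R X) (iota : fsl_elt L -> X -> \bar R),
    [/\ Dembedding iota, range iota = A,
        forall a x, D x -> iota a x = (a x)%:E &
        forall (a : fsl_elt L) x, ~ D x -> a x = 0].
Proof.
move=> dD [Acont Afin A0 AD AZ Apos].
pose res (h : X -> \bar R) x : R := if x \in D then fine (h x) else 0.
have resD h x : D x -> res h x = fine (h x).
  by move=> Dx; rewrite /res (mem_set Dx).
have resND h x : ~ D x -> res h x = 0 by move=> Dx; rewrite /res memNset.
pose C := res @` A.
have C0 : C (cst 0).
  by exists (cst 0%E) => //; apply/funext => x; rewrite /res; case: ifP.
have CD a b : C a -> C b -> C (fun x => a x + b x).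
  move=> [h Ah <-] [k Ak <-]; have [l Al lE] := AD _ _ Ah Ak.
  exists l => //; apply/funext => x; have [Dx|Dx] := pselect (D x).
    by rewrite !resD// lE// fineD// Afin.
  by rewrite !resND// addr0.
have CZ r a : C a -> C (fun x => r * a x).
  move=> [h Ah <-]; have [l Al lE] := AZ r _ Ah.
  exists l => //; apply/funext => x; have [Dx|Dx] := pselect (D x).
    by rewrite !resD// lE// fineM// Afin.
  by rewrite !resND// mulr0.
have Cpos a : C a -> C (fun x => Num.max (a x) 0).
  move=> [h Ah <-]; have [l Al lE] := Apos _ Ah.
  exists l => //; apply/funext => x; have [Dx|Dx] := pselect (D x).
    by rewrite !resD// lE// -{1}(fineK (Afin _ Ah _ Dx)) -EFin_max.
  by rewrite !resND// maxxx.
pose L := FunSublattice C0 CD CZ Cpos.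
have iotaP (a : fsl_elt L) : exists h, A h /\ res h = a.
  by have [h Ah hE] := fsl_eltP a; exists h.
have [iota iotaE] := choice iotaP.
have iA a : A (iota a) by case: (iotaE a).
have iE a x : D x -> iota a x = (a x)%:E.
  move=> Dx; have [_ <-] := iotaE a; rewrite resD// fineK//.
  exact: (Afin _ (iA a)).
have aND (a : fsl_elt L) x : ~ D x -> a x = 0.
  by move=> Dx; have [_ <-] := iotaE a; rewrite resND.
have iD (a : fsl_elt L) : Dspace X (iota a).
  split; first exact: Acont.
  move=> O O0 oO; have [x [Ox Dx]] := dD O O0 oO; exists x; split=> //=.
  exact: (Afin _ (iA a)).
have ic a : continuous (iota a) := Acont _ (iA a).
have uniq (a : fsl_elt L) (h : X -> \bar R) x : h t @[t --> x] --> h x ->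
    (forall t, D t -> h t = (a t)%:E) -> iota a x = h x.
  move=> hc hE; apply: (cvg_eq_on_dense (D := D)) => //.
  - exact: dense_closureT.
  - exact: ic.
  - by move=> t Dt; rewrite iE// hE.
exists L, iota; split=> //; last first.
  apply/seteqP; split=> [_ [a _ <-]//|h Ah].
  have Ch : res h \in fsl_pred L by apply/mem_set; exists h.
  exists (FslElt Ch) => //; apply/funext => x; apply: uniq; first exact: Acont.
  by move=> t Dt; rewrite /= resD// fineK// Afin.
split.
  move=> a b ab; apply: fsl_eqP => x; have [Dx|Dx] := pselect (D x).
    by have := iE a x Dx; rewrite ab iE// => -[].
  by rewrite !aND.
split=> //.
- move=> a b; split=> // x afin bfin.
  pose h t := (iota a t + iota b t)%E.
  apply: (uniq _ h) => [|t Dt].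
    by apply: cvgeD; [exact: fin_num_adde_defl|exact: ic|exact: ic].
  by rewrite /h !iE// fsl_funD EFinD.
- move=> r a; apply/funext => x; apply: uniq => [|t Dt].
    by apply: cvgeZl => //; exact: ic.
  by rewrite /Dscale iE// fsl_funZ EFinM.
- move=> a b; apply/funext => x.
  apply: (uniq _ (fun t => maxe (iota a t) (iota b t))) => [|t Dt].
    by apply: cvg_maxe; exact: ic.
  by rewrite !iE// fsl_vjoinE EFin_max.
- move=> a b; apply/funext => x.
  apply: (uniq _ (fun t => mine (iota a t) (iota b t))) => [|t Dt].
    by apply: cvg_mine; exact: ic.
  by rewrite !iE// fsl_vmeetE EFin_min.
Qed.

(** * Uniqueness of the Yosida space *)

Section DembeddingTheory.
Context {R : realType} {V : vectorLatticeType R} {X : topologicalType}.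
Context {iota : V -> X -> \bar R} (emb : Dembedding iota).
Implicit Types (a b : V) (x : X).

Lemma Demb_inj : injective iota. Proof. by case: emb. Qed.

Lemma Demb_continuous a : continuous (iota a).
Proof. by case: emb => _ [/(_ a)[]]. Qed.

Lemma DembD a b x : iota a x \is a fin_num -> iota b x \is a fin_num ->
  iota (a + b) x = (iota a x + iota b x)%E.
Proof. by move=> aD bD; have [_ [_ /(_ a b)[_ _ _ ->]]] := emb. Qed.

Lemma DembZ r a x : iota (r *: a) x = (r%:E * iota a x)%E.
Proof. by case: emb => _ [_ _ -> _ _]. Qed.

Lemma Demb_join a b x : iota (vjoin a b) x = maxe (iota a x) (iota b x).
Proof. by case: emb => _ [_ _ _ -> _]. Qed.

Lemma Demb_meet a b x : iota (vmeet a b) x = mine (iota a x) (iota b x).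
Proof. by case: emb => _ [_ _ _ _ ->]. Qed.

Lemma Demb0 x : iota 0 x = 0%E.
Proof. by rewrite -(scale0r 0) DembZ mul0e. Qed.

Lemma DembN a x : iota (- a) x = (- iota a x)%E.
Proof. by rewrite -scaleN1r DembZ EFinN mulN1e. Qed.

Lemma Demb_vabs a x : iota (vabs a) x = `|iota a x|%E.
Proof.
rewrite Demb_join DembN; case: (iota a x) => [r| |].
- by rewrite -EFinN -EFin_max maxrN.
- by rewrite max_l// leNye.
- by rewrite max_r// leNye.
Qed.

Lemma Demb_le a b : (forall x, (iota a x <= iota b x)%E) <-> a <= b.
Proof.
split=> [ab|ab x].
  have <- : vmeet a b = a.
    by apply: Demb_inj; apply/funext => x; rewrite Demb_meet min_l.
  exact: vmeet_ler.
have abE : vmeet a b = a.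
  by apply/eqP; rewrite eq_le vmeet_lel/= vle_meet lexx.
by rewrite -abE Demb_meet ge_min lexx orbT.
Qed.

End DembeddingTheory.

Lemma ideal_vjoin (R : realType) (V : vectorLatticeType R) (I : set V) a b :
  ideal I -> I a -> I b -> I (vjoin (vabs a) (vabs b)).
Proof.
move=> iI Ia Ib; have [_ ID _ Is] := iI.
have le1 : vabs a <= vabs a + vabs b.
  by rewrite -[leLHS]addr0 vlat_leD// vabs_ge0.
have le2 : vabs b <= vabs a + vabs b.
  by rewrite -[leLHS]add0r vlat_leD// vabs_ge0.
have j0 : 0 <= vjoin (vabs a) (vabs b).
  apply: le_trans (vabs_ge0 a) _.
  by have := vjoin_le (vabs a) (vabs b) (vjoin (vabs a) (vabs b));
    rewrite lexx => /esym/andP[].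
apply: (Is (vabs a + vabs b)); first by apply: ID; exact: ideal_vabs.
by rewrite (ger0_vabs j0) (ger0_vabs (le_trans (vabs_ge0 a) le1)) vjoin_le le1.
Qed.

Section YosidaUniqueness.
Context {R : realType} {V : vectorLatticeType R} (u : V) {X : ptopologicalType}.
Context {iota : V -> X -> \bar R}.
Hypotheses (emb : Dembedding iota) (iu : iota u = cst 1%E).
Hypotheses (cX : compact [set: X]) (hX : hausdorff_space X).
Hypothesis sep : separates01 (range iota).

Let point_ideal x : set V := [set a | iota a x = 0%E].

Let point_idealP x : ideal (point_ideal x).
Proof.
rewrite /point_ideal; split=> /=.
- exact: Demb0.
- by move=> a b a0 b0; rewrite (DembD emb) ?a0 ?b0// adde0.
- by move=> r a a0; rewrite (DembZ emb) a0 mule0.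
- move=> a b a0 /(Demb_le emb)/(_ x).
  by rewrite !(Demb_vabs emb) a0 abse0 leNgt abse_gt0 negbK => /eqP.
Qed.

Let point_idealNu x : ~ point_ideal x u.
Proof. by rewrite /point_ideal/= iu => /eqP; rewrite onee_eq0. Qed.

Let closed1 (x : X) : closed [set x].
Proof. exact: accessible_closed_set1 (hausdorff_accessible hX) x. Qed.

Let sep_point (x : X) (C : set X) : closed C -> ~ C x ->
  exists d, iota d x = 0%E /\ forall t, C t -> iota d t = 1%E.
Proof.
move=> cC Cx; have [|_ [[d _ <-] d0 d1]] := sep (@closed1 x) cC.
  by apply/seteqP; split=> // t [-> /Cx].
by exists d; split=> //; exact: d0.
Qed.

Let ideal_has_u (J : set V) a : ideal J -> J a ->
  (forall x, (1 <= `|iota a x|)%E) -> J u.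
Proof.
move=> [_ _ _ Js] Ja h; apply: (Js a) => //.
by apply/(Demb_le emb) => x; rewrite !(Demb_vabs emb) iu abse1.
Qed.

Let point_ideal_sub x (J : set V) : ideal J -> ~ J u ->
  point_ideal x `<=` J -> J = point_ideal x.
Proof.
move=> iJ Ju sub; apply/seteqP; split=> // c Jc; apply: contrapT => cx.
have [_ _ JZ _] := iJ.
have [e e0 ec] := abse_gt_fin (introN eqP cx).
pose C := [set t | (`|iota c t| <= e%:E)%E].
have cC : closed C.
  rewrite (_ : C = (abse \o iota c) @^-1` [set y | (y <= e%:E)%E])//.
  apply: preimage_closed; last exact: closed_ereal_ge_ereal.
  by move=> t _; apply: cvg_abse; exact: Demb_continuous.
have [|d [d0 d1]] := sep_point cC (x := x).
  by rewrite /C/= leNgt ec.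
apply: Ju; apply: ideal_has_u iJ (ideal_vjoin iJ (JZ e^-1 _ Jc) (sub _ d0)) _.
move=> t; rewrite (Demb_join emb) !(Demb_vabs emb) gee0_abs; last first.
  by rewrite le_max abse_ge0.
have ei : (0 <= (e^-1)%:E)%E by rewrite lee_fin invr_ge0 ltW.
rewrite le_max (DembZ emb) abseM (gee0_abs ei).
have [/d1 ->|/negP] := pselect (C t); first by rewrite abse1 lexx orbT.
rewrite -ltNge => /ltW h; apply/orP; left.
by rewrite -(mulVf (lt0r_neq0 e0)) EFinM lee_wpmul2l.
Qed.

Let point_maximal x : maximal_avoiding u (point_ideal x).
Proof. by split=> // J iJ Ju; exact: point_ideal_sub. Qed.

Let pt x : yosida_space u := YosidaPoint (point_maximal x).

Let finite_join (J : set V) (s : seq V) : ideal J ->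
  (forall a, a \in s -> J a) -> exists2 b, J b &
  forall a, a \in s -> forall x, (`|iota a x| <= `|iota b x|)%E.
Proof.
move=> iJ; elim: s => [|a s IH] Js.
  by exists 0 => //; case: iJ.
have [b sb|b Jb bP] := IH; first by apply: Js; rewrite inE sb orbT.
exists (vjoin (vabs a) (vabs b)).
  by apply: ideal_vjoin => //; apply: Js; rewrite mem_head.
move=> c cas x; rewrite (Demb_join emb) !(Demb_vabs emb).
rewrite [leRHS]gee0_abs; last first.
  by rewrite le_max abse_ge0.
rewrite le_max; move: cas; rewrite inE => /predU1P[->|/bP/(_ x) ->].
  by rewrite lexx.
by rewrite orbT.
Qed.

Let point_surj (M : yosida_space u) : exists x, pt x = M.
Proof.
have [iM Mu Mmax] := yosida_idealP M; have [_ _ MZ _] := iM.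
suff [x Mx] : exists x, M `<=` point_ideal x.
  have E : point_ideal x = M by exact: Mmax.
  exists x; case: M E {iM Mu Mmax MZ Mx} => M MP /= E; rewrite /pt.
  move: (point_maximal x); rewrite E => MP'.
  by congr YosidaPoint; exact: Prop_irrelevance.
apply: contrapT => nM.
have cov : [set: X] `<=` cover M (fun a => [set x | (1 < `|iota a x|)%E]).
  move=> x _; have : ~ M `<=` point_ideal x by move=> h; apply: nM; exists x.
  move=> /existsNP[a /not_implyP[Ma ax]].
  have [e e0 ea] := abse_gt_fin (introN eqP ax).
  exists (e^-1 *: a); first exact: MZ.
  have ei : (0 <= (e^-1)%:E)%E by rewrite lee_fin invr_ge0 ltW.
  rewrite /= (DembZ emb) abseM (gee0_abs ei).
  by rewrite -(mulVf (lt0r_neq0 e0)) EFinM lte_pmul2l// lte_fin invr_gt0.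
move: cX; rewrite compact_cover => /(_ _ _ _ _ cov)[|D DM Dcov].
  move=> a _.
  rewrite (_ : mkset _ = (abse \o iota a) @^-1` [set y | (1 < y)%E])//.
  apply: open_comp; last exact: open_ereal_gt_ereal.
  by move=> t _; apply: cvg_abse; exact: Demb_continuous.
have [|b Mb bP] := @finite_join M (finmap.enum_fset D) iM.
  by move=> a /DM; rewrite inE.
apply: Mu; apply: ideal_has_u iM Mb _ => x.
have [a aD] := Dcov x I; rewrite /= => /ltW a1.
exact: le_trans a1 (bP a aD x).
Qed.

Lemma yosida_space_is_embedding : yosida_space_is u iota.
Proof.
have [g gK] := choice point_surj.
have inj x y : pt x = pt y -> x = y.
  move=> xy; apply: contrapT => nxy.
  have [d [dx dy]] := sep_point (@closed1 y) (nxy : ~ [set y] x).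
  have : yosida_ideal (pt x) d by [].
  by rewrite xy /= /point_ideal/= dy// => /eqP; rewrite onee_eq0.
have hK : cancel pt g by move=> x; apply: inj; rewrite gK.
have hc : continuous pt.
  apply/continuousP => _ [F ->].
  rewrite (_ : _ @^-1` _ = \bigcup_(a in F) iota a @^-1` [set~ 0%E]).
    apply: bigcup_open => a Fa; apply: open_comp.
      by move=> t _; exact: Demb_continuous.
    apply: closed_openC; apply: accessible_closed_set1.
    exact: hausdorff_accessible (@ereal_hausdorff R).
  apply/seteqP; split=> x.
    by move=> /existsNP[a /not_implyP[Fa ax]]; exists a.
  by move=> [a Fa ax] /(_ a Fa).
have gc : continuous g.
  apply/continuousP => U oU; exists [set a | forall x, ~ U x -> iota a x = 0%E].
  apply/seteqP; split=> M; rewrite -(gK M) /= hK.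
    move=> Ux /=; rewrite /hull/= => sub.
    have [|_ [[d _ <-] d0 d1]] := sep (open_closedC oU) (@closed1 (g M)).
      by apply/seteqP; split=> // t [/= Ut tg]; rewrite tg in Ut.
    have := sub d d0; rewrite /point_ideal/= d1// => /eqP.
    by rewrite onee_eq0.
  by move=> h; apply: contrapT => nU; apply: h => a; exact.
exists pt, (fun a => iota a \o g); split.
- by split=> //; exists g; split.
- split.
  + split.
      move=> a b /(congr1 (fun k => k \o pt)) ab; apply: (Demb_inj emb).
      by apply/funext => x; have := congr1 (@^~ x) ab; rewrite /= hK.
    have DK f : Dspace X f -> Dspace _ (f \o g).
      move=> [fc fd]; split.
        by move=> M; apply: continuous_comp; [exact: gc|exact: fc].
      move=> O [M OM] oO.
      have [||x [Ox fx]] := fd (pt @^-1` O).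
      * by exists (g M); rewrite /= gK.
      * by move/continuousP : hc; exact.
      * by exists (pt x); split=> //=; rewrite hK.
    have [_ [eD eA eZ eJ eM]] := emb.
    split.
    * by move=> a; exact: DK.
    * move=> a b; have [aD bD abD abE] := eA a b.
      by split; [exact: DK..|move=> M; exact: abE].
    * by move=> r a; rewrite eZ.
    * by move=> a b; rewrite eJ.
    * by move=> a b; rewrite eM.
  + by rewrite iu.
  + move=> C E cC cE CE.
    have [|||_ [[d _ <-] d0 d1]] := sep (C := pt @^-1` C) (E := pt @^-1` E).
    * by apply: preimage_closed => // t _; exact: hc.
    * by apply: preimage_closed => // t _; exact: hc.
    * by rewrite -preimage_setI CE preimage_set0.
    * exists (iota d \o g); split; first by exists d.
        by move=> M CM; apply: d0; rewrite /= gK.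
      by move=> M EM; apply: d1; rewrite /= gK.
- by move=> a; apply/funext => x; rewrite /= hK.
Qed.

End YosidaUniqueness.

Lemma ZD_homeomorphism (T U : topologicalType) (h : T -> U) :
  homeomorphism h -> ZD T -> ZD U.
Proof.
move=> [hc [g [hK gK gc]]] [_ Tb]; split; first by move=> C [].
move=> M W WM.
have [|D [cD Dg] DW] := Tb (g M) (h @^-1` W).
  by apply: hc; rewrite gK.
exists (g @^-1` D); first by split; [exact: preimage_clopen|].
by move=> N /DW; rewrite /= gK.
Qed.

Lemma ZD_cantor_space : ZD cantor_space.
Proof.
split; first by move=> C [].
move=> x W Wx.
have [D [Dx cD] DW] := zero_dimensional_cvg cantor_space_hausdorff
  cantor_zero_dimensional cantor_space_compact Wx.
by exists D.
Qed.

(** * The lattice C(X) + S *)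

Section CplusSTheory.
Context {R : realType} {X : topologicalType} (f : nat -> X -> \bar R).
Hypothesis fcont : forall n, continuous (f n).
Hypothesis fge0 : forall n x, (0 <= f n x)%E.
Hypothesis fdisj : forall m n x,
  f m x \isn't a fin_num -> f n x \isn't a fin_num -> m = n.

Let D : set X := [set x | forall n, f n x \is a fin_num].
Hypothesis dD : dense D.

Let lin (I : seq nat) (r : nat -> R) x := (\sum_(i <- I) (r i)%:E * f i x)%E.

Let linD I r x : D x -> lin I r x = (\sum_(i <- I) r i * fine (f i x))%:E.
Proof.
move=> Dx; rewrite -sumEFin; apply: eq_bigr => i _.
by rewrite EFinM fineK.
Qed.

Let lin_fin I r x : (forall i, i \in I -> r i = 0 \/ f i x \is a fin_num) ->
  lin I r x \is a fin_num.
Proof.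
move=> h; apply/sum_fin_numP => i /h[->|fi] _; first by rewrite mul0e.
exact: fin_numM.
Qed.

Let lin_cont I r : uniq I -> continuous (lin I r).
Proof.
elim: I => [_|i I IH /= /andP[iI uI]] x; rewrite /lin.
  by under eq_fun do rewrite big_nil; exact: cvg_cst.
under eq_fun do rewrite big_cons; rewrite ?big_cons.
apply: cvgeD; [|by apply: cvgeZl => //; exact: fcont|exact: IH].
have [fi|fi] := boolP (f i x \is a fin_num).
  by apply: fin_num_adde_defr; exact: fin_numM.
apply: fin_num_adde_defl; apply: lin_fin => j jI; right.
by apply: contraT => fj; rewrite (fdisj fi fj) jI in iI.
Qed.

Let lin_Dspace I r : uniq I -> Dspace X (lin I r).
Proof.
move=> uI; split; first exact: lin_cont.
move=> O O0 oO; have [x [Ox Dx]] := dD O0 oO; exists x; split=> //=.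
by rewrite linD.
Qed.

Let lin_sub I J r : uniq I -> uniq J -> {subset I <= J} -> forall x,
  lin I r x = lin J (fun i => if i \in I then r i else 0) x.
Proof.
move=> uI uJ IJ x; rewrite /lin.
have pI : perm_eq I [seq i <- J | i \in I].
  apply: uniq_perm => //; first exact: filter_uniq.
  by move=> i; rewrite mem_filter andb_idr//; exact: IJ.
rewrite (perm_big _ pI) big_filter big_mkcond/=; apply: eq_bigr => i _.
by case: ifP; rewrite ?mul0e.
Qed.

Let Dsum_lin I r s : Dsum [seq Dscale (r i) (f i) | i <- I] s ->
  forall x, D x -> s x = lin I r x.
Proof.
elim: I s => [|i I IH] s /=; first by move=> -> x _; rewrite /lin big_nil.
move=> [k /IH kE [_ _ _ sE]] x Dx; rewrite /lin big_cons -/(lin I r x) -kE//.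
apply: sE; first by rewrite fin_numM.
by rewrite kE// linD.
Qed.

Let lin_Dsum I r : uniq I -> Dsum [seq Dscale (r i) (f i) | i <- I] (lin I r).
Proof.
elim: I => [_|i I IH uiI] /=.
  by apply/funext => x; rewrite /lin big_nil.
have /andP[iI uI] := uiI; exists (lin I r); first exact: IH.
split; [|exact: lin_Dspace|exact: lin_Dspace|].
  have -> : Dscale (r i) (f i) = lin [:: i] r.
    by apply/funext => x; rewrite /lin big_seq1.
  exact: lin_Dspace.
by move=> x _ _; rewrite /lin big_cons.
Qed.

Let Dspace_EFin (g : X -> R) : continuous g -> Dspace X (EFin \o g).
Proof.
move=> gc; split; first exact: continuous_EFin_comp.
by move=> O [x Ox] _; exists x; split.
Qed.

Let clin (g : X -> R) I r x := ((g x)%:E + lin I r x)%E.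

Let clin_cont g I r : continuous g -> uniq I -> continuous (clin g I r).
Proof.
move=> gc uI x; apply: cvgeD; first exact: fin_num_adde_defr.
  exact: continuous_EFin_comp.
exact: lin_cont.
Qed.

Let clin_CplusS g I r : continuous g -> uniq I -> CplusS f (clin g I r).
Proof.
move=> gc uI; exists g, (lin I r); split=> //.
  by exists I, r; split=> //; exact: lin_Dsum.
split=> //; [exact: Dspace_EFin|exact: lin_Dspace|].
split; first exact: clin_cont.
move=> O O0 oO; have [x [Ox Dx]] := dD O0 oO; exists x; split=> //=.
by rewrite /clin linD.
Qed.

Let CplusS_clin h : CplusS f h ->
  exists g I r, [/\ continuous g, uniq I & h = clin g I r].
Proof.
move=> [g [s [gc [I [r [uI /Dsum_lin sE]]] [_ _ [hc _] hE]]]].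
exists g, I, r; split=> //; apply/funext => x.
apply: (cvg_eq_on_dense (D := D)); [exact: ereal_hausdorff|
  exact: dense_closureT|exact: hc|exact: clin_cont|].
by move=> t Dt; rewrite hE ?sE// linD.
Qed.

Lemma CplusS_continuous h : CplusS f h -> continuous h.
Proof.
by move=> /CplusS_clin[g [I [r [gc uI ->]]]]; exact: clin_cont.
Qed.

Lemma CplusS_fin_num h x y : CplusS f h ->
  (forall n, (f n x \is a fin_num) = (f n y \is a fin_num)) ->
  h x \is a fin_num -> h y \is a fin_num.
Proof.
move=> /CplusS_clin[g [I [r [gc uI ->]]]] fxy; rewrite !fin_numD/=.
move=> /sum_fin_numP hx; apply: lin_fin => i iI.
have [->|r0] := eqVneq (r i) 0; [by left|right].
have := hx i iI isT; rewrite -fxy; have := fge0 i x.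
case: (f i x) => [s _ _ //|_|//].
case: (ltgtP (r i) 0) r0 => // ri _.
- by rewrite lt0_muley ?lte_fin.
- by rewrite gt0_muley ?lte_fin.
Qed.

Lemma CplusS_EFin (g : X -> R) : continuous g -> CplusS f (EFin \o g).
Proof.
move=> gc; suff <- : clin g [::] (cst 0) = EFin \o g by exact: clin_CplusS.
by apply/funext => x; rewrite /clin /lin big_nil adde0.
Qed.

Lemma CplusS_generator n : CplusS f (f n).
Proof.
suff <- : clin (cst 0) [:: n] (cst 1) = f n.
  by apply: clin_CplusS => // x; exact: cvg_cst.
by apply/funext => x; rewrite /clin /lin big_seq1 add0e mul1e.
Qed.

Let clin_on g I r : continuous g -> uniq I -> exists2 l, CplusS f l &
  forall x, D x -> l x = (g x + \sum_(i <- I) r i * fine (f i x))%:E.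
Proof.
move=> gc uI; exists (clin g I r); first exact: clin_CplusS.
by move=> x Dx; rewrite /clin linD.
Qed.

Let pos_part_fin I (r : nat -> R) x :
  let p := lin I (fun i => Num.max (r i) 0) x in
  let q := lin I (fun i => Num.max (- r i) 0) x in
  p \is a fin_num \/ q \is a fin_num.
Proof.
move=> p q; have [|pfin] := boolP (p \is a fin_num); [by left|right].
have [i iI [ri fi]] : exists2 i, i \in I & 0 < r i /\ f i x \isn't a fin_num.
  apply: contrapT => h; move/negP: pfin; apply; apply: lin_fin => i iI.
  apply: contrapT => /not_orP[ri fi]; apply: h; exists i => //.
  split; last exact/negP.
  by rewrite ltNge; apply/negP => /max_r.
apply: lin_fin => j jI; have [fj|fj] := boolP (f j x \is a fin_num).
  by right.
by left; rewrite -(fdisj fi fj) max_r// oppr_le0 ltW.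
Qed.

(* With p and q the parts of the linear combination carrying its positive and
   negative coefficients, (g + p - q)^+ = p - min(q - g, p), and the minimum is
   finite everywhere because p and q are never both infinite. *)
Let clin_pos g I r : continuous g -> uniq I -> exists2 l, CplusS f l &
  forall x, D x -> l x = maxe (clin g I r x) 0%E.
Proof.
move=> gc uI.
pose p := lin I (fun i => Num.max (r i) 0).
pose q := lin I (fun i => Num.max (- r i) 0).
pose G x := mine (q x - (g x)%:E)%E (p x).
have p0 x : (0 <= p x)%E.
  by apply: sume_ge0 => i _; rewrite mule_ge0// lee_fin le_max lexx orbT.
have q0 x : (0 <= q x)%E.
  by apply: sume_ge0 => i _; rewrite mule_ge0// lee_fin le_max lexx orbT.
have Gc : continuous G.
  move=> x; apply: cvg_mine; last exact: lin_cont.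
  apply: cvgeD; first exact: fin_num_adde_defl.
    exact: lin_cont.
  by apply: cvgeN; exact: continuous_EFin_comp.
have Gfin x : G x \is a fin_num.
  rewrite /G; have := p0 x; have := q0 x; have := @pos_part_fin I r x.
  rewrite -/(p x) -/(q x).
  by case: (p x) => [s| |]; case: (q x) => [t| |] //= [] //= _ _ _;
    rewrite ?minye ?miney -?EFin_min.
have [|l Al lE] := @clin_on (fun x => - fine (G x)) I
    (fun i => Num.max (r i) 0) _ uI.
  by move=> x; apply: cvgN; exact: continuous_fine_comp.
exists l => // x Dx; rewrite lE// /clin /G /p /q !linD//.
set P := \sum_(i <- I) Num.max (r i) 0 * _.
set Q := \sum_(i <- I) Num.max (- r i) 0 * _; set S := \sum_(i <- I) r i * _.
have -> : S = P - Q.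
  rewrite /S /P /Q -sumrB; apply: eq_bigr => i _; rewrite -mulrBl.
  congr (_ * _); have [ri|/ltW ri] := leP 0 (r i).
    by rewrite (max_r (_ : - r i <= 0)) ?subr0// oppr_le0.
  by rewrite (max_l (_ : 0 <= - r i)) ?sub0r ?opprK// oppr_ge0.
rewrite -EFinN -!EFinD -EFin_min -EFin_max /=; congr EFin.
by rewrite oppr_min addr_maxl opprB addNr addrAC addrA.
Qed.

Lemma CplusS_sublattice : finite_on_sublattice D (CplusS f).
Proof.
split.
- exact: CplusS_continuous.
- move=> h /CplusS_clin[g [I [r [gc uI ->]]]] x Dx.
  by rewrite /clin linD.
- exact: (CplusS_EFin (fun=> cvg_cst _)).
- move=> _ _ /CplusS_clin[g [I [r [gc uI ->]]]]
    /CplusS_clin[k [J [s [kc uJ ->]]]].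
  pose K := undup (I ++ J).
  have IK : {subset I <= K} by move=> i iI; rewrite mem_undup mem_cat iI.
  have JK : {subset J <= K} by move=> i iJ; rewrite mem_undup mem_cat iJ orbT.
  have uK : uniq K by exact: undup_uniq.
  have [|l Al lE] := @clin_on (fun x => g x + k x) K
    (fun i => (if i \in I then r i else 0) + (if i \in J then s i else 0)) _ uK.
    by move=> x; apply: cvgD; [exact: gc|exact: kc].
  exists l => // x Dx.
  rewrite lE// /clin (lin_sub r uI uK IK) (lin_sub s uJ uK JK) !linD//.
  rewrite -!EFinD addrACA -big_split/=; congr (_ + _)%:E.
  by apply: eq_bigr => i _; rewrite mulrDl.
- move=> c _ /CplusS_clin[g [I [r [gc uI ->]]]].
  have [|l Al lE] := @clin_on (fun x => c * g x) I (fun i => c * r i) _ uI.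
    by move=> x; apply: cvgM; [exact: cvg_cst|exact: gc].
  exists l => // x Dx; rewrite lE// /clin linD// -EFinD -EFinM mulrDr.
  by rewrite mulr_sumr; under [in RHS]eq_bigr do rewrite mulrA.
- by move=> _ /CplusS_clin[g [I [r [gc uI ->]]]]; exact: clin_pos.
Qed.

End CplusSTheory.

Lemma CplusS_separates01 (R : realType) (X : topologicalType)
    (f : nat -> X -> \bar R) :
  (forall g : X -> R, continuous g -> CplusS f (EFin \o g)) ->
  normal_space X -> separates01 (CplusS f).
Proof.
move=> Cf nX C E cC cE CE.
have [g [gc g0 g1 _]] := urysohn_ext_itv (R := R) nX cC cE CE ltr01.
exists (EFin \o g); split; first exact: Cf.
  by move=> x Cx /=; rewrite (g0 (g x)).
by move=> x Ex /=; rewrite (g1 (g x)).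
Qed.

(** * Failure of SMP *)

Lemma cantor_dense_avoid_seq (w : nat -> cantor_space) :
  dense [set x | forall n, x <> w n].
Proof.
move=> O [x Ox] oO.
pose c k : cantor_space := fun n => if (n < k)%N then x n else ~~ w (n - k)%N n.
have cx : c k @[k --> \oo] --> x.
  apply/(@pointwise_cvgP nat bool) => n; apply: cvg_near_cst.
  by exists n.+1 => // k /= nk; rewrite /c nk.
have [k _ /(_ k (leqnn k)) Ock] := cx _ (open_nbhs_nbhs (conj oO Ox)).
exists (c k); split=> // n /(congr1 (fun v : cantor_space => v (n + k)%N)).
by rewrite /c ltnNge leq_addl/= addnK; case: (w n _).
Qed.

Lemma not_SMP_of_linked_infinities (R : realType) (X : topologicalType)
    (D Y : set X) (L : fun_sublattice R X) (iota : fsl_elt L -> X -> \bar R)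
    (u : fsl_elt L) (y z : nat -> X) :
  dense D -> Dembedding iota ->
  (forall a x, D x -> iota a x = (a x)%:E) ->
  (forall (a : fsl_elt L) x, ~ D x -> a x = 0) ->
  iota u = cst 1%E -> separates01 (range iota) ->
  clopen Y -> range y `<=` Y -> Y `<=` closure (range y) ->
  range z `<=` ~` Y ->
  (forall a n, iota a (z n) \is a fin_num -> iota a (y n) \is a fin_num) ->
  (forall n, exists a, iota a (y n) \isn't a fin_num) ->
  ~ SMP (fsl_elt L).
Proof.
move=> dD emb iE aND iu sep [oY cY] ysub ydense zsub link infy smp.
have uE x : D x -> u x = 1.
  by move=> Dx; have := iE u x Dx; rewrite iu => -[].
have oZ : open (~` Y) by exact: closed_openC.
have cZ : closed (~` Y) by exact: open_closedC.
have [|_ [[e _ <-] eY eZ]] := sep Y (~` Y) cY cZ; first exact: setICr.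
have [|_ [[d _ <-] dZ dY]] := sep (~` Y) Y cZ cY; first exact: setICl.
have eYE x : Y x -> e x = 0.
  by move=> Yx; have [/(iE e)|/aND//] := pselect (D x); rewrite eY// => -[].
have eZE x : D x -> ~ Y x -> e x = 1.
  by move=> /(iE e) + Yx; rewrite eZ// => -[].
pose B : set (fsl_elt L) := [set a | forall x, ~ Y x -> a x = 0].
have iB : ideal B.
  split=> //.
  - by move=> a b Ba Bb x Yx; rewrite fsl_funD Ba// Bb// addr0.
  - by move=> r a Ba x Yx; rewrite fsl_funZ Ba// mulr0.
  - move=> a b Ba /fsl_leP ba x Yx; apply/eqP.
    by have := ba x; rewrite !fsl_vabsE Ba// normr0 normr_le0.
have bB : band B.
  split=> // S s SB [sub slb] x Yx.
  have [[a Sa]|S0] := pselect (S !=set0); last first.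
    have : s <= s - u by apply: slb => b Sb; case: S0; exists b.
    have [t [_ Dt]] : ([set: X] `&` D) !=set0.
      by apply: dD; [exists x|exact: openT].
    move=> /fsl_leP/(_ t); rewrite fsl_funD fsl_funN uE//.
    by rewrite lerDl oppr_ge0 ler10.
  have [Dx|/aND//] := pselect (D x).
  pose w := vmeet (vjoin s 0) e.
  have wE t : w t = Num.min (Num.max (s t) 0) (e t).
    by rewrite fsl_vmeetE fsl_vjoinE.
  have /slb : ubound S (s - w).
    move=> b Sb; apply/fsl_leP => t; rewrite fsl_funD fsl_funN wE.
    have /fsl_leP/(_ t) bs := sub b Sb.
    have [Yt|Yt] := pselect (Y t).
      by rewrite eYE// min_r ?subr0// le_max lexx orbT.
    rewrite (SB b Sb t Yt) in bs *.
    by rewrite max_l// subr_ge0 ge_min lexx.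
  move=> /fsl_leP/(_ x); rewrite fsl_funD fsl_funN wE eZE// lerDl oppr_ge0.
  have /fsl_leP/(_ x) := sub a Sa; rewrite (SB a Sa x Yx) => sx0.
  rewrite max_l// ge_min [1 <= 0]ler10 orbF => sx.
  by apply/eqP; rewrite eq_le sx sx0.
have y0Y : Y (y 0%N) by apply: ysub; exists 0%N.
have nB : B <> [set 0].
  have [x [Yx Dx]] : (Y `&` D) !=set0 by apply: dD => //; exists (y 0%N).
  have Bd : B d.
    move=> t Yt; have [/(iE d)|/aND//] := pselect (D t).
    by rewrite dZ// => -[].
  move=> BE; move: Bd; rewrite BE /= => d0.
  have := iE d x Dx; rewrite dY// d0 fsl_fun0 => -[] /eqP.
  by rewrite oner_eq0.
have [P [[[iP _] [P' [[iP' _] [PP' sum]]]] P0 PB]] := smp B bB nB.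
have disj q q' x : P q -> P' q' -> q x = 0 \/ q' x = 0.
  move=> Pq Pq'; have m0 : 0 <= vmeet (vabs q) (vabs q').
    by rewrite vle_meet !vabs_ge0.
  have : [set 0] (vmeet (vabs q) (vabs q')).
    rewrite -PP'; split.
      by case: iP => _ _ _; apply; [exact: Pq|rewrite ger0_vabs// vmeet_lel].
    by case: iP' => _ _ _; apply; [exact: Pq'|rewrite ger0_vabs// vmeet_ler].
  move=> /(congr1 (fun m : fsl_elt L => m x)).
  rewrite fsl_vmeetE !fsl_vabsE; case: leP => _ /eqP; rewrite normr_eq0 => /eqP.
    by left.
  by right.
have [p [p' [Pp Pp' upp']]] := sum u.
have [x0 [Dx0 px0]] : exists x, D x /\ p x <> 0.
  apply: contrapT => h; apply: P0; apply/seteqP.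
  split=> [q Pq|_ ->]; last by case: iP.
  apply: fsl_eqP => x; have [Dx|/aND ->//] := pselect (D x).
  have p0 : p x = 0 by apply: contrapT => px; apply: h; exists x.
  have [//|p'0] := disj q p' x Pq Pp'.
  have := uE x Dx; rewrite upp' fsl_funD p0 p'0 addr0 => /eqP.
  by rewrite eq_sym oner_eq0.
have px01 : p x0 = 1.
  have [//|p'0] := disj p p' x0 Pp Pp'.
  by have := uE x0 Dx0; rewrite upp' fsl_funD p'0 addr0.
have Yx0 : Y x0 by apply: contrapT => nY; apply: px0; exact: PB.
pose U := [set x | (0 < iota p x)%E].
have oU : open U.
  rewrite (_ : U = iota p @^-1` [set t | (0 < t)%E])//.
  apply: open_comp; last exact: open_ereal_gt_ereal.
  by move=> t _; exact: Demb_continuous.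
have Ux0 : U x0 by rewrite /U/= iE// px01.
have [_ [[n _ <-] Uy]] := ydense x0 Yx0 U (open_nbhs_nbhs (conj oU Ux0)).
have [a /negP] := infy n; apply.
have [q [q' [Pq Pq' aE]]] := sum a.
have <- : iota q (y n) = iota a (y n).
  apply: (cvg_eq_on_dense (D := U `&` D)); [exact: ereal_hausdorff|
    exact: dense_closureI|exact: Demb_continuous|exact: Demb_continuous|].
  move=> t [Ut Dt]; rewrite !iE// aE fsl_funD.
  have [pt|->] := disj p q' t Pp Pq'; last by rewrite addr0.
  by move: Ut; rewrite /U/= iE// pt ltxx.
apply: link; suff -> : iota q (z n) = cst 0%E (z n) by [].
apply: (cvg_eq_on_dense (D := ~` Y `&` D)); [exact: ereal_hausdorff|
  |exact: Demb_continuous|exact: cvg_cst|].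
  by apply: dense_closureI => //; apply: zsub; exists n.
by move=> t [Yt Dt]; rewrite iE// (PB q Pq).
Qed.

Theorem theorem7p1 (R : realType) (Y : set cantor_space)
    (y z : nat -> cantor_space) (f : nat -> cantor_space -> \bar R)
    (Yclopen : clopen Y) (Yneq0 : Y <> set0) (YneqT : Y <> setT)
    (yinj : injective y) (ysub : range y `<=` Y)
    (ydense : Y `<=` closure (range y))
    (zinj : injective z) (zsub : range z `<=` ~` Y)
    (zdense : ~` Y `<=` closure (range z))
    (fD : forall n, Dspace cantor_space (f n))
    (fge1 : forall n x, (1 <= f n x)%E)
    (finfty : forall n, f n @^-1` [set +oo%E] = [set y n; z n]) :
  exists (V : vectorLatticeType R) (iota : V -> cantor_space -> \bar R) (u : V),
    [/\ Dembedding iota, range iota = CplusS f & iota u = cst 1%E] /\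
    [/\ archimedean V, weak_order_unit u, yosida_space_is u iota,
        ZD (yosida_space u) & ~ SMP V].
Proof.
have fge0 n x : (0 <= f n x)%E by apply: le_trans (fge1 n x).
have fcont n : continuous (f n) by case: (fD n).
have ninf n x : f n x \isn't a fin_num <-> x = y n \/ x = z n.
  have -> : (x = y n \/ x = z n) = [set y n; z n] x by [].
  rewrite -finfty /= ge0_fin_numE// -leNgt leye_eq.
  by split=> [/eqP|->].
have yz m n : y m <> z n.
  move=> E; have : Y (z n) by rewrite -E; apply: ysub; exists m.
  by apply: zsub; exists n.
have finy m n : f n (y m) \isn't a fin_num <-> n = m.
  by rewrite ninf; split=> [[/yinj|/yz]|->] //; left.
have finz m n : f n (z m) \isn't a fin_num <-> n = m.
  by rewrite ninf; split=> [[/esym/yz|/zinj]|->] //; right.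
have fdisj m n x :
    f m x \isn't a fin_num -> f n x \isn't a fin_num -> m = n.
  by move=> /ninf[->/finy|->/finz].
pose D : set cantor_space := [set x | forall n, f n x \is a fin_num].
have dD : dense D.
  pose w n := if odd n then y n./2 else z n./2.
  move=> O O0 oO; have [x [Ox xw]] := cantor_dense_avoid_seq w O0 oO.
  exists x; split=> // n; apply: contraT => /ninf[xy|xz].
    by have := xw n.*2.+1; rewrite /w /= odd_double/= uphalf_double.
  by have := xw n.*2; rewrite /w odd_double doubleK.
have [L [iota [emb ran iE aND]]] :=
  Dembedding_of_sublattice dD (CplusS_sublattice fcont fge0 fdisj dD).
have Cg := CplusS_EFin fcont fdisj dD.
have C1 : CplusS f (EFin \o cst 1) by apply: Cg => x; exact: cvg_cst.
have [u _ uE] : range iota (cst 1%E) by rewrite ran; exact: C1.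
have Aiota a : CplusS f (iota a) by rewrite -ran; exists a.
have sep : separates01 (range iota).
  rewrite ran; apply: CplusS_separates01; first exact: Cg.
  exact: compact_normal cantor_space_hausdorff cantor_space_compact.
have ys := yosida_space_is_embedding emb uE cantor_space_compact
  cantor_space_hausdorff sep.
have u1 x : D x -> u x = 1.
  by move=> Dx; have := iE u x Dx; rewrite uE => -[].
exists (fsl_elt L), iota, u; split=> //; split=> //.
- exact: fsl_archimedean.
- split.
    rewrite lt_def; apply/andP; split.
      have [|x [_ Dx]] := dD setT _ openT; first by exists (y 0%N).
      apply/eqP => u0; have /eqP := u1 x Dx.
      by rewrite u0 fsl_fun0 eq_sym oner_eq0.
    apply/fsl_leP => x; rewrite fsl_fun0.
    by have [/u1 ->|/aND ->] := pselect (D x); rewrite ?ler01.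
  move=> a m0; apply: fsl_eqP => x; have [Dx|/aND ->//] := pselect (D x).
  have : vmeet (vabs a) u x = 0 by rewrite m0.
  rewrite fsl_vmeetE fsl_vabsE u1//; case: leP => _ /eqP.
    by rewrite normr_eq0 => /eqP.
  by rewrite oner_eq0.
- have [h [_ [hh _ _]]] := ys.
  exact: ZD_homeomorphism hh ZD_cantor_space.
- apply: (not_SMP_of_linked_infinities dD emb iE aND uE sep Yclopen ysub
    ydense zsub).
    move=> a n; apply: (CplusS_fin_num fcont fge0 fdisj dD) => // k.
    by apply/idP/idP; apply: contraLR; [move/finy/finz|move/finz/finy].
  move=> n; have [a _ aE] : range iota (f n).
    by rewrite ran; exact: CplusS_generator.
  by exists a; rewrite aE; apply/finy.
Qed.
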